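(* Let $\Phi$ be a finite set of formulas, let $\mathfrak A$ be a $\Phi$-quasimodel, and let $\varphi$ be a formula satisfied in $\mathfrak A$, i.e. $\varphi\in t(w^\ast)$ for some $w^\ast\in|\mathfrak A|$. Then there exists a realizing path $\vec w^\ast$ of $\mathfrak A$ such that $\langle\lim\mathfrak A,\vec w^\ast\rangle\models\varphi$.
   Context: Language $\mathsf L^\ast$: formulas built from a countable set of propositional variables using $\wedge$, $\neg$, the unary operators $f$ and $[f]$, and, for each finite set $\Gamma$ of formulas, $\Diamond\Gamma$; $\langle f\rangle=\neg[f]\neg$. A dynamic topological model (dtm) is a topological space $X$ with a continuous map $f_X$ and a valuation with $[\![\alpha\wedge\beta]\!]=[\![\alpha]\!]\cap[\![\beta]\!]$, $[\![\neg\alpha]\!]=X\setminus[\![\alpha]\!]$, $[\![f\alpha]\!]=f_X^{-1}[\![\alpha]\!]$, $[\![[f]\alpha]\!]=\bigcap_{n\ge0}f_X^{-n}[\![\alpha]\!]$, $[\![\Diamond\Gamma]\!]=\{[\![\gamma]\!]:\gamma\in\Gamma\}^\ast$, where $\mathcal S^\ast$ is the union of all $E$ such that $A\cap E$ is dense in $E$ for all $A\in\mathcal S$. $\mathrm{sub}(\Phi)$: subformulas; $\mathrm{sub}_\pm(\Phi)=\mathrm{sub}(\Phi)\cup\neg\mathrm{sub}(\Phi)$ ($\neg\neg\psi$ identified with $\psi$). A weak type is a finite set $\Psi$ of formulas, not containing both $\psi$ and $\neg\psi$, with $\psi\wedge\vartheta\in\Psi\Rightarrow\psi,\vartheta\in\Psi$,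 $\neg(\psi\wedge\vartheta)\in\Psi\Rightarrow\neg\psi\in\Psi$ or $\neg\vartheta\in\Psi$, $[f]\psi\in\Psi\Rightarrow\psi\in\Psi$. A $\Phi$-type is a weak type $\Psi\subseteq\mathrm{sub}_\pm(\Phi)$ containing $\psi$ or $\neg\psi$ for each $\psi\in\mathrm{sub}(\Phi)$. Preorders carry the down-set topology; $[v]$ is the cluster of $v$. A $\Phi$-typed preorder $(S,\preccurlyeq,t)$ assigns a $\Phi$-type to each point so that $\Diamond\Gamma\in t(w)$ implies there is $v\preccurlyeq w$ with each $\gamma\in\Gamma$ in $t(u)$ for some $u\sim v$, and $\neg\Diamond\Gamma\in t(w)$, $v\preccurlyeq w$ imply there is $\gamma\in\Gamma$ with $\neg\gamma\in t(u)$ for all $u\sim v$. A relation is continuous if preimages of open sets are open. $(\Psi,\Psi')$ is sensible if $f\psi\in\Psi\Rightarrow\psi\in\Psi'$, $\neg f\psi\in\Psi\Rightarrow\neg\psi\in\Psi'$, $[f]\psi\in\Psi\Rightarrow[f]\psi\in\Psi'$, $\langle f\rangle\psi\in\Psi\Rightarrow\psi\in\Psi$ or $\langle f\rangle\psi\in\Psi'$. A relation $\mapsto$ is $\omega$-sensible if it is continuous, serial, all its pairs have sensible types, and whenever $\langle f\rangle\psi\in\mathrm{sub}_\pm(\Phi)\cap t(w)$ there are $v$, $N\ge0$ with $w\mapsto^Nv$ and $\psi\in t(v)$. A $\Phi$-quasimodel is a $\Phi$-typed preorder with an $\omega$-sensible relation $\mapsto$. A realizing path is a sequence $\langle w_n\rangle_{n<\omega}$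 with $w_n\mapsto w_{n+1}$ such that whenever $\langle f\rangle\psi\in t(w_n)$ there is $K\ge n$ with $\psi\in t(w_K)$. $\lim\mathfrak A$ is the dtm on the set of realizing paths with the subspace topology of the product of down-set topologies on $|\mathfrak A|^{\mathbb N}$, the shift map $\sigma$, and $[\![p]\!]=\{\vec w:p\in t(w_0)\}$.
   Formalization: The preorder of the quasimodel is additionally assumed to have no infinite strictly descending chain (true if finite); without this the claim fails, e.g. on reversed ω with the identity relation, alternating p and q, and ¬◇{p,q} in every type. *)

(* Defs.v *)
From HB Require Import structures.
From mathcomp Require Import all_boot all_order.
From mathcomp Require Import all_classical.
From mathcomp Require Import topology.

Set Implicit Arguments.
Unset Strict Implicit.
Unset Printing Implicit Defensive.

Import Order.TTheory.

Local Open Scope classical_set_scope.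

(** * Formulas *)

(* A formula is a negation-free head with a sign: [Signed true c] is [c] and
   [Signed false c] is its negation.  Negation flips the sign, so that [¬¬ψ] and
   [ψ] are literally the same formula.  The propositional variables are indexed
   by [nat], and the finite set [Γ] in [◇Γ] is given by a list of its
   elements; every clause below depends on this list only through
   membership. *)
Inductive head (F : Type) : Type :=
  | HVar of nat
  | HAnd of F & F
  | HNext of F
  | HHence of F
  | HTangle of seq F.
Arguments HVar {F}.

Inductive formula : Type := Signed of bool & head formula.

HB.instance Definition _ := gen_eqMixin formula.
HB.instance Definition _ := gen_choiceMixin formula.

Definition Var (p : nat) : formula := Signed true (HVar p).
Definition And (a b : formula) : formula := Signed true (HAnd a b).
Definition Neg (a : formula) : formula :=
  let: Signed s c := a in Signed (~~ s) c.
(* f a *)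
Definition Next (a : formula) : formula := Signed true (HNext a).
(* [f] a *)
Definition Hence (a : formula) : formula := Signed true (HHence a).
(* <f> a *)
Definition Event (a : formula) : formula := Neg (Hence (Neg a)).
Definition Tangle (G : seq formula) : formula := Signed true (HTangle G).

Lemma NegK : involutive Neg.
Proof. by case=> s c /=; rewrite negbK. Qed.

(* A negated formula [¬ψ] has as subformulas itself and those of [ψ]. *)
Fixpoint sub1 (a : formula) : set formula :=
  let: Signed s c := a in
  [set Signed s c; Signed true c] `|`
  match c with
  | HVar _ => set0
  | HAnd b b' => sub1 b `|` sub1 b'
  | HNext b => sub1 b
  | HHence b => sub1 b
  | HTangle G => foldr setU set0 (map sub1 G)
  end.

Definition sub (Phi : set formula) : set formula := \bigcup_(a in Phi) sub1 a.

Definition subpm (Phi : set formula) : set formula :=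
  sub Phi `|` Neg @` sub Phi.

(** * Dynamic topological models *)

(* [A `&` E] is dense in the subspace [E] iff [E] lies in its closure. *)
Definition dense_in {X : topologicalType} (B E : set X) : Prop :=
  E `<=` closure B.

Definition tangle {X : topologicalType} (S : set (set X)) : set X :=
  \bigcup_(E in [set E | forall A, S A -> dense_in (A `&` E) E]) E.

Record dtm : Type := Dtm {
  dtm_space :> topologicalType;
  dtm_map : dtm_space -> dtm_space;
  dtm_map_continuous : continuous dtm_map;
  dtm_val : nat -> set dtm_space }.

Fixpoint sem {X : dtm} (a : formula) : set X :=
  let: Signed s c := a in
  let A :=
    match c with
    | HVar p => dtm_val p
    | HAnd b b' => sem b `&` sem b'
    | HNext b => @dtm_map X @^-1` sem b
    | HHence b => \bigcap_n iter n (@dtm_map X) @^-1` sem b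
    | HTangle G => tangle [set A | A \in map sem G]
    end in
  if s then A else ~` A.

Definition models (X : dtm) (x : X) (a : formula) : Prop := sem a x.
Arguments models : clear implicits.

(** * Types *)

Definition weak_type (Psi : set formula) : Prop :=
  [/\ finite_set Psi,
      forall a, ~ (Psi a /\ Psi (Neg a)),
      forall a b, Psi (And a b) -> Psi a /\ Psi b,
      forall a b, Psi (Neg (And a b)) -> Psi (Neg a) \/ Psi (Neg b) &
      forall a, Psi (Hence a) -> Psi a].

Definition is_type (Phi Psi : set formula) : Prop :=
  [/\ weak_type Psi,
      Psi `<=` subpm Phi &
      forall a, sub Phi a -> Psi a \/ Psi (Neg a)].

(** * Preorders *)

(* A copy of the carrier of a preorder, with the down-set topology. *)
Definition downset {d} (T : preorderType d) : Type := T.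

Definition down_closed {d} {T : preorderType d} (U : set (downset T)) : Prop :=
  forall v w : T, (v <= w)%O -> U w -> U v.

Section DownsetTopology.
Context {d : Order.disp_t} (T : preorderType d).

Let down_setT : @down_closed d T setT. Proof. by []. Qed.

Let down_setI : setI_closed (@down_closed d T).
Proof. by move=> A B dA dB v w vw [Aw Bw]; split; [exact: dA Aw|exact: dB Bw]. Qed.

Let down_bigcup (I : Type) (g : I -> set (downset T)) :
  (forall i, down_closed (g i)) -> down_closed (\bigcup_i g i).
Proof. by move=> dg v w vw [i _ gw]; exists i => //; exact: dg gw. Qed.

HB.instance Definition _ := Choice.on (downset T).
HB.instance Definition _ :=
  isOpenTopological.Build (downset T) down_setT down_setI down_bigcup.

Lemma open_downsetE (U : set (downset T)) : open U = down_closed U.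
Proof. by []. Qed.

End DownsetTopology.

(* No infinite strictly descending chains; [v < w] means [v <= w] and not
   [w <= v].  Clusters may be infinite, and every finite preorder qualifies. *)
Definition wf_preorder {d} (T : preorderType d) : Prop :=
  well_founded (fun v w : T => (v < w)%O).

Lemma finite_wf_preorder {d} (T : preorderType d) :
  finite_set [set: T] -> wf_preorder T.
Proof.
move=> /finite_seqP[s sT]; rewrite /wf_preorder.
have ins v : v \in s by have : [set: T] v by []; rewrite sT.
pose m (w : T) := count (fun v => (v < w)%O) s.
suff H n : forall w, m w < n -> Acc (fun v w : T => (v < w)%O) w.
  by move=> w; exact: (H (m w).+1).
elim: n => [w|n IH w wn]; first by rewrite ltn0.
constructor=> v vw; apply: IH; rewrite ltnS in wn; apply: leq_trans wn.
rewrite /m -!size_filter; set sv := [seq u <- s | (u < v)%O].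
set sw := [seq u <- s | (u < w)%O].
have sub_vw : subseq sv sw.
  have -> : sv = [seq u <- sw | (u < v)%O].
    rewrite /sw -filter_predI; apply: eq_filter => u /=.
    by case uv: (u < v)%O => //=; rewrite (lt_trans uv vw).
  exact: filter_subseq.
rewrite ltn_neqAle size_subseq // andbT (size_subseq_leqif sub_vw).
apply/negP => /eqP eq_vw.
have : v \in sw by rewrite mem_filter vw ins.
by rewrite -eq_vw mem_filter ltxx.
Qed.

(* [cluster_eq v w] is v ~ w, that is, w belongs to the cluster [v]. *)
Definition cluster_eq {d} {T : preorderType d} (v w : T) : Prop :=
  (v <= w)%O /\ (w <= v)%O.

Record typed_preorder (d : Order.disp_t) (Phi : set formula) : Type :=
  TypedPreorder {
    tp_carrier :> preorderType d;
    tp_type : tp_carrier -> set formula;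
    tp_typeP : forall w, is_type Phi (tp_type w);
    tp_tangle : forall G w, tp_type w (Tangle G) ->
      exists2 v, (v <= w)%O &
        forall a, a \in G -> exists2 u, cluster_eq u v & tp_type u a;
    tp_tangleN : forall G w v, tp_type w (Neg (Tangle G)) -> (v <= w)%O ->
      exists2 a, a \in G & forall u, cluster_eq u v -> tp_type u (Neg a) }.

(** * Quasimodels *)

Definition continuous_rel {X : topologicalType} (R : X -> X -> Prop) : Prop :=
  forall U : set X, open U -> open [set w | exists2 v, U v & R w v].

Definition serial {T : Type} (R : T -> T -> Prop) : Prop :=
  forall w, exists v, R w v.

Fixpoint rel_iter {T : Type} (N : nat) (R : T -> T -> Prop) (w v : T) : Prop :=
  if N is N'.+1 then exists2 u, R w u & rel_iter N' R u v else w = v.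

Definition sensible (Psi Psi' : set formula) : Prop :=
  [/\ forall a, Psi (Next a) -> Psi' a,
      forall a, Psi (Neg (Next a)) -> Psi' (Neg a),
      forall a, Psi (Hence a) -> Psi' (Hence a) &
      forall a, Psi (Event a) -> Psi a \/ Psi' (Event a)].

Definition omega_sensible d Phi (A : typed_preorder d Phi)
    (R : A -> A -> Prop) : Prop :=
  [/\ @continuous_rel (downset A) R,
      serial R,
      forall w v, R w v -> sensible (tp_type w) (tp_type v) &
      forall w a, (subpm Phi `&` tp_type w) (Event a) ->
        exists v N, rel_iter N R w v /\ tp_type v a].

Record quasimodel (d : Order.disp_t) (Phi : set formula) : Type := Quasimodel {
  qm_typed :> typed_preorder d Phi;
  qm_rel : qm_typed -> qm_typed -> Prop;
  qm_relP : omega_sensible qm_rel }.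

(** * The limit model *)

Section Limit.
Context {d : Order.disp_t} {Phi : set formula} (A : quasimodel d Phi).

(* [{ptws nat -> _}] carries the product topology. *)
Definition realizing_path : set {ptws nat -> downset A} :=
  [set w | (forall n, qm_rel (w n) (w n.+1)) /\
           forall n a, tp_type (w n : A) (Event a) ->
             exists2 K, n <= K & tp_type (w K : A) a].

Definition seq_shift (w : {ptws nat -> downset A}) : {ptws nat -> downset A} :=
  fun n => w n.+1.

Lemma seq_shift_realizing w : realizing_path w -> realizing_path (seq_shift w).
Proof.
move=> [wR wE]; split=> [n|n a /wE[[|K] // nK wKa]]; first exact: wR.
by exists K.
Qed.

(* As a type, [realizing_path] carries the subspace topology. *)
Definition lim_shift (w : realizing_path) : realizing_path :=
  exist _ (seq_shift (val w)) (mem_set (seq_shift_realizing (set_mem (valP w)))).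

Lemma seq_shift_continuous : continuous seq_shift.
Proof.
move=> w; have FF : Filter (seq_shift x @[x --> w]).
  exact: (@fmap_filter _ _ seq_shift (nbhs w) (nbhs_filter w)).
apply/(@cvg_sup _ _ _ (seq_shift x @[x --> w]) (seq_shift w)) => n U.
move=> [_ [[V oV <-] /= Vw] VU].
apply: (filterS VU); have := @proj_continuous nat (fun=> downset A) n.+1 w.
by apply; exact: open_nbhs_nbhs.
Qed.

Lemma lim_shift_continuous : continuous lim_shift.
Proof.
apply/continuousP => _ [V oV <-].
exists (seq_shift @^-1` V) => //.
by apply: open_comp => // w _; exact: seq_shift_continuous.
Qed.

Definition limit_model : dtm :=
  @Dtm realizing_path lim_shift lim_shift_continuous
    (fun p => [set w | tp_type (val w 0 : A) (Var p)]).

End Limit.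
Arguments realizing_path {d Phi} A.
Arguments limit_model {d Phi} A.

(* Main.v *)
Require Import Defs.
From mathcomp Require Import all_boot all_order.
From mathcomp Require Import all_classical.
From mathcomp Require Import topology.

Set Implicit Arguments.
Unset Strict Implicit.
Unset Printing Implicit Defensive.

Import Order.TTheory.

Local Open Scope classical_set_scope.

(** Every point starts a realizing path: concatenate finite segments, each
    realizing all eventualities of its first point; an eventuality arising in
    the middle of a segment is either met there or handed on to the next one.
    A realizing path satisfies every formula in the type of its head, by
    induction on the formula.
    For [◇Γ] below [v ≼ w_0], the witness [E] is the set of realizing paths that
    start above [v]: continuity of the relation lets any [u ≼ x_0] be continued
    below [x_0, ..., x_n], so paths with head of type [γ] are dense in [E].
    For [¬◇Γ], given [x ∈ E] with minimal head [v] (here well-foundedness is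
    used), some [γ ∈ Γ] fails on the whole cluster of [v], hence everywhere in
    [E] on the neighbourhood [y_0 ≼ v] of [x]. *)

(** [formula] is nested through [head] and [seq], so the recursion is written by hand, with an inner
    induction on the list [G]. *)
Lemma formula_nested_ind (P : formula -> Prop) :
  (forall s p, P (Signed s (HVar p))) ->
  (forall s a b, P a -> P b -> P (Signed s (HAnd a b))) ->
  (forall s a, P a -> P (Signed s (HNext a))) ->
  (forall s a, P a -> P (Signed s (HHence a))) ->
  (forall s G, (forall a, a \in G -> P a) -> P (Signed s (HTangle G))) ->
  forall a, P a.
Proof.
move=> HV HA HN HH HT; fix IH 1 => -[s [p|a b|a|a|G]].
- exact: HV.
- by apply: HA.
- by apply: HN.
- by apply: HH.
(* [discriminate] rather than [by], which could close the goal with the unguarded [IH a]. *)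
- apply: HT; elim: G => [a|b G IHG a]; first by rewrite in_nil; discriminate.
  by rewrite in_cons => /orP[/eqP ->|]; [exact: IH|exact: IHG].
Qed.

Section RealizingPaths.
Context {d : Order.disp_t} {Phi : set formula} (A : quasimodel d Phi).
Local Notation R := (@qm_rel d Phi A).
Local Notation t w := (tp_type (w : A)).

Let rR : rel A := fun v w => `[< R v w >].

(** * Realizing paths from a given point *)

Lemma event_step (v w : A) a :
  R v w -> t v (Event a) -> t v a \/ t w (Event a).
Proof. by have [_ _ sens _] := qm_relP A => /sens[_ _ _]; exact. Qed.

Lemma event_path (w : A) s a : path rR w s -> t w (Event a) ->
  (exists2 u, u \in w :: s & t u a) \/ t (last w s) (Event a).
Proof.
elim: s w => [|v s IH] w /=; first by right.
move=> /andP[/asboolP wv vs] /(event_step wv)[wa|va].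
  by left; exists w => //; exact: mem_head.
have [[u us ua]|?] := IH _ vs va; last by right.
by left; exists u => //; rewrite in_cons us orbT.
Qed.

Lemma rel_iter_path N (w v : A) : rel_iter N R w v ->
  exists2 s, path rR w s & last w s = v.
Proof.
elim: N w => [w ->|N IH w [u wu /IH[s us sv]]]; first by exists [::].
by exists (u :: s) => //=; rewrite us andbT; exact/asboolP.
Qed.

(** Prolonging a segment keeps the eventualities already met. The next one is met on it or pending
    at its last point, where omega-sensibility supplies an extension. Segments are non-empty so that
    concatenating them gives an infinite path. *)
Lemma realizing_segment_seq (l : seq formula) (w : A) : exists s,
  [/\ path rR w s, s != [::] & forall a, a \in l -> t w (Event a) ->
      exists2 u, u \in w :: s & t u a].
Proof.
have [_ ser _ omega] := qm_relP A.
elim: l => [|a l [s [ws s0 sl]]].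
  by have [v wv] := ser w; exists [:: v]; split=> //=; rewrite andbT; exact/asboolP.
suff [s' [ss' s'a]] : exists s', path rR (last w s) s' /\
    (t w (Event a) -> exists2 u, u \in w :: s ++ s' & t u a).
  exists (s ++ s'); split.
  - by rewrite cat_path ws.
  - by case: (s) s0.
  - move=> b; rewrite in_cons => /orP[/eqP -> //|bl wb].
    have [u us ub] := sl b bl wb.
    by exists u => //; rewrite -cat_cons mem_cat us.
have [wa|nwa] := pselect (t w (Event a)); last by exists [::].
have [[u us ua]|la] := event_path ws wa.
  by exists [::]; split=> // _; exists u; rewrite ?cats0.
have [_ tsub _] := tp_typeP (last w s).
have [v [N [lv va]]] := omega _ _ (conj (tsub _ la) la).
have [s' ss' ls'] := rel_iter_path lv.
exists s'; split=> // _; exists v => //.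
by rewrite -ls' -last_cat mem_last.
Qed.

Lemma realizing_segment (w : A) : exists s,
  [/\ path rR w s, s != [::] & forall a, t w (Event a) ->
      exists2 u, u \in w :: s & t u a].
Proof.
have [[+ _ _ _ _] _ _] := tp_typeP w.
move=> /finite_seqP[l tl].
(* The map inverts [Event], up to a sign that [NegK] absorbs. *)
have [s [ws s0 sl]] := realizing_segment_seq [seq Neg (match a with
  Signed _ (HHence b) => b | _ => a end) | a <- l] w.
exists s; split=> // a wa; apply: sl => //.
have al : Event a \in l by have := wa; rewrite tl.
by apply/mapP; exists (Event a) => //=; rewrite NegK.
Qed.

Definition is_realizing (w : nat -> A) : Prop := realizing_path A w.

Lemma realizing_from (w : A) : exists2 x, is_realizing x & x 0 = w.
Proof.
have [g gP] := choice realizing_segment.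
(* A state is the current point and what is left of the current segment. *)
pose fuel (p : A * seq A) := if p.2 is [::] then g p.1 else p.2.
pose step (p : A * seq A) := (head p.1 (fuel p), behead (fuel p)).
pose st n := iter n step (w, [::]).
have stP n : path rR (st n).1 (st n).2.
  elim: n => //= n; rewrite -/(st n); case: (st n) => v [|u s] /=.
    by have [+ _ _] := gP v; rewrite /step /fuel/=; case: (g v) => //= u s /andP[].
  by case/andP.
have fuelP n : path rR (st n).1 (fuel (st n)).
  have := stP n; rewrite /fuel; case: (st n) => v [|//] _ /=.
  by have [] := gP v.
have fuel0 n : fuel (st n) != [::].
  by rewrite /fuel; case: (st n) => v [|//] /=; have [] := gP v.
have xR n : R (st n).1 (st n.+1).1.
  apply/asboolP; rewrite [st n.+1]/= -/(st n) /step /=.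
  by have := fuelP n; have := fuel0 n; case: (fuel _) => //= u s _ /andP[].
(* Inside a segment the states just read off [s]. The remainder clause needs [0 < i]: at [i = 0] the
   segment [s] may be fresh while [(st n).2] is still empty. *)
have run s n : fuel (st n) = s -> forall i, i <= size s ->
    (st (n + i)).1 = nth (st n).1 ((st n).1 :: s) i /\
    (0 < i -> (st (n + i)).2 = drop i s).
  move=> fs; elim=> [|i IH] is_; first by rewrite addn0.
  have [i1 i2] := IH (ltnW is_).
  have fi : fuel (st (n + i)) = drop i s.
    case: i {IH} is_ i1 i2 => [|i] is_ i1 i2; first by rewrite addn0 drop0.
    rewrite /fuel i2 //; case E : (drop _ _) => //.
    by move: is_; rewrite -subn_gt0 -size_drop E.
  rewrite addnS [st _.+1]/= -/(st (n + i)) /step fi (drop_nth (st n).1 is_) /=.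
  by split.
have visited n s u : fuel (st n) = s -> u \in (st n).1 :: s ->
    exists2 K, n <= K & (st K).1 = u.
  move=> fs /(nthP (st n).1)[i /= is_ <-].
  by exists (n + i); [exact: leq_addr|have [] := run s n fs i is_].
(* Either the eventuality is met, or it is pending when the segment runs out; the segment started
   there by [g] then meets it. *)
have drain n a : t (st n).1 (Event a) ->
    (exists2 K, n <= K & t (st K).1 a) \/
    exists2 m, n <= m & (st m).2 = [::] /\ t (st m).1 (Event a).
  move=> na; have [E|ne] := eqVneq (st n).2 [::]; first by right; exists n.
  have fs : fuel (st n) = (st n).2 by rewrite /fuel; case: (st n).2 ne.
  have [[u us ua]|la] := event_path (stP n) na.
    by left; have [K nK Ku] := visited _ _ _ fs us; exists K; rewrite ?Ku.
  right; exists (n + size (st n).2); first exact: leq_addr.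
  have [r1 r2] := run _ _ fs _ (leqnn _).
  rewrite r1 r2 ?drop_size; last by case: (st n).2 ne.
  by rewrite -[X in nth _ _ X]/(size ((st n).1 :: (st n).2)).-1 nth_last.
exists (fun n => (st n).1) => //; split=> // n a /drain[//|[m nm [m0 ma]]].
have fm : fuel (st m) = g (st m).1 by rewrite /fuel m0.
have [_ _ /(_ a ma)[u us ua]] := gP (st m).1.
have [K mK Ku] := visited _ _ _ fm us.
by exists K; rewrite ?Ku //; exact: leq_trans mK.
Qed.

(** * Paths close to a given path *)

Lemma realizing_cons (u : A) x :
  is_realizing x -> R u (x 0) -> is_realizing (fun n => if n is k.+1 then x k else u).
Proof.
move=> [xR xE] ux; split=> [[|n] //|[|n] a]; last first.
  by move=> /xE[K nK Ka]; exists K.+1.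
move=> /(event_step ux)[ua|/xE[K _ Ka]]; first by exists 0.
by exists K.+1.
Qed.

Lemma realizing_below (x : nat -> A) (u : A) n :
  (forall n, R (x n) (x n.+1)) -> (u <= x 0)%O ->
  exists y, [/\ is_realizing y, y 0 = u & forall i, i <= n -> (y i <= x i)%O].
Proof.
elim: n x u => [|n IH] x u xR ux.
  have [y yr yu] := realizing_from u.
  by exists y; split=> // i; rewrite leqn0 => /eqP ->; rewrite yu.
have [cont _ _ _] := qm_relP A.
have dx1 : @down_closed _ A [set v | (v <= x 1)%O].
  by move=> v w vw wx; exact: le_trans wx.
(* The preimage of the down-set of [x 1] is open, hence down-closed, and contains [x 0]. *)
have [u' u'x uu'] : exists2 u', (u' <= x 1)%O & R u u'.
  by apply: (cont _ dx1 u (x 0) ux); exists (x 1) => //=; exact: lexx.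
have [y [yr yu yx]] := IH (fun n => x n.+1) u' (fun n => xR n.+1) u'x.
exists (fun n => if n is k.+1 then y k else u); split=> //.
  by apply: realizing_cons => //; rewrite yu.
by case.
Qed.

(** The down-set of a point is its least neighbourhood, so the filter generated by the sets [B n]
    converges to [x] in each coordinate, hence in the product. *)
Lemma nbhs_realizing (x : realizing_path A) (U : set (realizing_path A)) :
  nbhs x U -> exists n, forall y : realizing_path A,
    (forall i, i <= n -> (val y i <= val x i :> A)%O) -> U y.
Proof.
move=> [_ [[V oV <-] /= Vx] VU].
pose B n := [set y : {ptws nat -> downset A} |
  forall i, i <= n -> (y i <= val x i :> A)%O].
pose F := filter_from setT B.
have FF : Filter F.
  apply: filter_from_filter; first by exists 0.
  move=> i j _ _; exists (maxn i j) => // y yB.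
  by split=> k ki; apply: yB; rewrite leq_max ki ?orbT.
have Fx : F --> (val x : {ptws nat -> downset A}).
  apply/cvg_sup => n W [_ [[O oO <-] /= Ox] OW].
  exists n => // y yB; apply: OW => /=.
  exact: oO (yB n (leqnn n)) Ox.
have [n _ BV] := Fx V (open_nbhs_nbhs (conj oV Vx)).
by exists n => y yB; apply: VU; apply: BV.
Qed.

Lemma nbhs_head_le (x : realizing_path A) (v : A) : (val x 0 <= v)%O ->
  nbhs x [set y : realizing_path A | (val y 0 <= v :> A)%O].
Proof.
move=> xv; apply: open_nbhs_nbhs; split=> //.
exists ([set y : {ptws nat -> downset A} | (y 0 <= v :> A)%O]) => //.
have cont0 : continuous (fun y : {ptws nat -> downset A} => y 0).
  exact: (@proj_continuous nat (fun=> downset A) 0).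
apply: (@open_comp _ _ (fun y : {ptws nat -> downset A} => y 0)
  [set w : downset A | (w <= v :> A)%O]); first by move=> y _; exact: cont0.
by rewrite open_downsetE => w u wu uv; exact: le_trans uv.
Qed.

(** * Truth in the limit model *)

Lemma realizing_hence (x : nat -> A) a n :
  is_realizing x -> t (x 0) (Hence a) -> t (x n) (Hence a).
Proof.
move=> [xR _] x0a; elim: n => [//|n IH].
by have [_ _ sens _] := qm_relP A; have [_ _ + _] := sens _ _ (xR n); exact.
Qed.

Lemma val_iter_lim_shift (x : realizing_path A) n :
  val (iter n (@lim_shift _ _ A) x) 0 = val x n.
Proof.
suff H m : val (iter n (@lim_shift _ _ A) x) m = val x (n + m) by rewrite H addn0.
by elim: n m => // n IH m; rewrite /= /seq_shift IH addnS addSn.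
Qed.

Lemma limit_truth (wfA : wf_preorder A) a (x : realizing_path A) :
  t (val x 0) a -> @sem (limit_model A) a x.
Proof.
have xr (y : realizing_path A) : is_realizing (val y) := set_mem (valP y).
pose P a := (forall x : realizing_path A,
    t (val x 0) a -> @sem (limit_model A) a x) /\
  (forall x : realizing_path A,
    t (val x 0) (Neg a) -> ~ @sem (limit_model A) a x).
suff H : P a by exact: H.1.
(* Flipping the sign exchanges the two halves of [P], so only positive formulas remain. *)
have sgn c : P (Signed true c) -> forall s, P (Signed s c).
  by move=> [H1 H2] [] //; split=> y ya; [exact: H2|move=> /=; apply; exact: H1].
have [_ _ sens _] := qm_relP A.
elim/formula_nested_ind: a {x}.
- move=> s p; apply: sgn; split=> [//|x] xN xp.
  by have [[_ + _ _ _] _ _] := tp_typeP (val x 0 : A); apply; split; [exact: xp|exact: xN].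
- move=> s a b [a1 a2] [b1 b2]; apply: sgn; split=> x;
    have [[_ _ tA tN _] _ _] := tp_typeP (val x 0 : A).
    by move=> /tA[xa xb]; split; [exact: a1|exact: b1].
  by move=> /tN[xa|xb] [? ?]; [exact: a2 xa _|exact: b2 xb _].
- move=> s a [a1 a2]; apply: sgn; split=> x;
    have [+ + _ _] := sens _ _ ((xr x).1 0) => h1 h2.
    by move=> /h1; exact: (a1 (lim_shift x)).
  by move=> /h2; exact: (a2 (lim_shift x)).
- move=> s a [a1 a2]; apply: sgn; split=> x.
    move=> xa n _; apply: a1; rewrite val_iter_lim_shift.
    have [[_ _ _ _ tH] _ _] := tp_typeP (val x n : A).
    exact/tH/realizing_hence.
  (* [Neg (Hence a)] is [Event (Neg a)]. *)
  rewrite -[a]NegK => xa xsem; have [K _] := (xr x).2 0 _ xa.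
  rewrite -val_iter_lim_shift => /a2; apply.
  by have := xsem K Logic.I; rewrite NegK.
- move=> s G IH; apply: sgn; split=> x.
    move=> xG; have [v vx vG] := tp_tangle xG.
    exists ([set y : realizing_path A | (v <= val y 0 :> A)%O]); last exact: vx.
    move=> _ /= /mapP[a aG ->] y vy U /nbhs_realizing[n yU].
    have [u [uv vu] ua] := vG a aG.
    (* As [u] is in the cluster of [v], it lies below [val y 0] yet above [v], so [z] stays in the
       chosen set. *)
    have [z [zr zu zy]] := realizing_below n (xr y).1 (le_trans uv vy).
    exists (exist _ (z : {ptws nat -> downset A}) (mem_set zr)); split.
      split; first by apply: (IH a aG).1; rewrite /= zu.
      by rewrite /= zu.
    exact: yU.
  move=> xG [E Edense Ex].
  pose Q v := (v <= val x 0 :> A)%O -> forall y : realizing_path A,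
    val y 0 = v -> ~ E y.
  suff /(_ (val x 0) (lexx _) x erefl) : forall v, Q v by exact.
  elim/(well_founded_ind wfA) => v IHv vx y yv Ey.
  have [a aG va] := tp_tangleN xG vx.
  have semaG : [set B | B \in map (@sem (limit_model A)) G] (sem a).
    by apply/mapP; exists a.
  have yle : (val y 0 <= v :> A)%O by rewrite yv.
  have [z [[za Ez] /= zv]] := Edense _ semaG y Ey _ (nbhs_head_le yle).
  (* Either the head of [z] is in the cluster of [v], where [a] is refuted, or it is strictly below
     [v] and the induction hypothesis applies. *)
  have [vz|nvz] := boolP (v <= val z 0 :> A)%O.
    by apply: (IH a aG).2 za; apply: va.
  apply: (IHv (val z 0) _ _ z erefl Ez); last exact: le_trans vx.
  by rewrite lt_leAnge zv.
Qed.

End RealizingPaths.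

Theorem mainTheorem3 (Phi : set formula) (finPhi : finite_set Phi)
    (d : Order.disp_t) (A : quasimodel d Phi) (wfA : wf_preorder A)
    (phi : formula) (satphi : exists w : A, tp_type w phi) :
  exists w : realizing_path A, models (limit_model A) w phi.
Proof.
have [w wphi] := satphi; have [x xr x0] := realizing_from w.
exists (exist _ (x : {ptws nat -> downset A}) (mem_set xr)).
by apply: limit_truth => //=; rewrite x0.
Qed.
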